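(* Let $(X,d)$ be a compact metric space and $\phi$ a regular expansive continuous flow on $X$. If $x_0\in X$ is a spiral point, then $\omega(x_0)$ is a periodic orbit.
   Context: A continuous flow is a continuous map $\phi\colon\mathbb{R}\times X\to X$, $\phi_t=\phi(t,\cdot)$, with $\phi_0=\mathrm{id}$, $\phi_{t+s}=\phi_s\circ\phi_t$; regular means no fixed points. Let $Rep$ be the set of increasing homeomorphisms $h\colon\mathbb{R}\to\mathbb{R}$ with $h(0)=0$. $\phi$ is expansive if for every $\varepsilon>0$ there is $\delta>0$ such that whenever $x,y\in X$, $h\in Rep$ and $d(\phi_t(x),\phi_{h(t)}(y))\le\delta$ for all $t\in\mathbb{R}$, then $y\in\phi_{[-\varepsilon,\varepsilon]}(x)$. A point $x\in X$ is a spiral point if there are $\tau>0$ and a continuous $g\colon\mathbb{R}\to\mathbb{R}$ with $g(t)>\tau+t$ for all $t\ge0$ and $d(\phi_t(x),\phi_{g(t)}(x))\to0$ as $t\to+\infty$. $\omega(x)=\{z:\exists t_k\to\infty,\ \phi_{t_k}(x)\to z\}$. A periodic orbit is the orbit $\{\phi_t(p):t\in\mathbb{R}\}$ of a point $p$ with $\phi_T(p)=p$ for some $T>0$. *)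

(* Defs.v *)
From Stdlib Require Import Reals List.
Open Scope R_scope.

Record is_metric {X : Type} (d : X -> X -> R) : Prop := {
  d_nonneg : forall x y, 0 <= d x y;
  d_zero   : forall x y, d x y = 0 <-> x = y;
  d_sym    : forall x y, d x y = d y x;
  d_tri    : forall x y z, d x z <= d x y + d y z
}.

Definition d_open {X : Type} (d : X -> X -> R) (U : X -> Prop) : Prop :=
  forall x, U x -> exists r, 0 < r /\ forall y, d x y < r -> U y.

Definition d_compact {X : Type} (d : X -> X -> R) : Prop :=
  forall (I : Type) (U : I -> X -> Prop),
    (forall i, d_open d (U i)) ->
    (forall x, exists i, U i x) ->
    exists l : list I, forall x, exists i, In i l /\ U i x.

Definition is_flow {X : Type} (d : X -> X -> R) (phi : R -> X -> X) : Prop :=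
  (forall t x eps, 0 < eps -> exists del, 0 < del /\
      forall s y, Rabs (s - t) < del -> d x y < del ->
        d (phi t x) (phi s y) < eps) /\
  (forall x, phi 0 x = x) /\
  (forall t s x, phi (t + s) x = phi s (phi t x)).

Definition regular_flow {X : Type} (phi : R -> X -> X) : Prop :=
  ~ exists x, forall t, phi t x = x.

Definition Rep (h : R -> R) : Prop :=
  (forall s t, s < t -> h s < h t) /\
  continuity h /\
  (exists g : R -> R, (forall t, g (h t) = t) /\ (forall y, h (g y) = y)
                      /\ continuity g) /\
  h 0 = 0.

Definition expansive {X : Type} (d : X -> X -> R) (phi : R -> X -> X) : Prop :=
  forall eps, 0 < eps -> exists del, 0 < del /\
    forall x y h, Rep h ->
      (forall t, d (phi t x) (phi (h t) y) <= del) ->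
      exists s, - eps <= s <= eps /\ y = phi s x.

Definition spiral_point {X : Type} (d : X -> X -> R) (phi : R -> X -> X)
    (x : X) : Prop :=
  exists tau, 0 < tau /\ exists g : R -> R, continuity g /\
    (forall t, 0 <= t -> g t > tau + t) /\
    (forall e, 0 < e -> exists T, forall t, t >= T ->
        d (phi t x) (phi (g t) x) < e).

Definition omega {X : Type} (d : X -> X -> R) (phi : R -> X -> X)
    (x : X) (z : X) : Prop :=
  exists tk : nat -> R,
    (forall M, exists N, forall k, (N <= k)%nat -> tk k > M) /\
    (forall e, 0 < e -> exists N, forall k, (N <= k)%nat ->
        d (phi (tk k) x) z < e).

Definition periodic_orbit {X : Type} (phi : R -> X -> X) (A : X -> Prop)
    : Prop :=
  exists p T, 0 < T /\ phi T p = p /\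
    forall z, A z <-> exists t, z = phi t p.

(* Main.v *)
(* Expansiveness is used in a uniform form: if two orbit pieces are close, up to a
   reparametrization, on a long time window, then at its centre they are as close as
   desired, up to a small time shift.  Iterating [g] gives a map [G] with [G t >= t + L]
   and the orbit of [x0] at time [G t] close to the orbit at time [t] from some [T] on.
   If the orbit from [T] on is [r]-shadowed by a later part of itself, then at times
   [G t >= T + L] the error improves to [r/2], and precomposing with [G], at a cost of
   [r/2], gives an [r]-shadowing that starts one turn further.  So the single piece
   [[T, G T]] is [r]-close to every turn of the whole forward orbit, with time
   distortion controlled uniformly in the number of turns.  The limits of the turns are
   then pairwise close along their full orbits, so by expansiveness they lie on a single
   orbit; comparing a limit with the limit of the next turns shows that this orbit is
   periodic.  Reparametrizations are handled as integer-indexed time sequences with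
   steps in [[a/2, 3a/2]], and limits are taken along a free ultrafilter, which avoids
   diagonal extraction. *)
Require Import Defs.
From Stdlib Require Import Reals Lra Lia ZArith List Classical ClassicalEpsilon.
From mathcomp Require filter.
Open Scope R_scope.

(** * Free ultrafilters on the natural numbers and limits along them *)

Record free_ultrafilter (U : (nat -> Prop) -> Prop) : Prop := {
  uf_sub : forall A B : nat -> Prop, (forall n, A n -> B n) -> U A -> U B;
  uf_and : forall A B : nat -> Prop, U A -> U B -> U (fun n => A n /\ B n);
  uf_ex : forall A : nat -> Prop, U A -> exists n, A n;
  uf_or : forall A : nat -> Prop, U A \/ U (fun n => ~ A n);
  uf_ge : forall N, U (fun n => (N <= n)%nat)
}.

Lemma free_ultrafilter_exists : exists U, free_ultrafilter U.
Proof.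
destruct (@filter.ultraFilterLemma nat filter.eventually filter.eventually_filter)
  as [G [UG sG]].
pose proof (filter.filter_filter (ProperFilter := filter.ultra_proper (UltraFilter:=UG))) as FG.
exists G; constructor.
- intros A B AB HA; exact (filter.filterS AB HA).
- intros A B HA HB; exact (filter.filterI HA HB).
- intros A HA.
  apply NNPP; intro H.
  apply (filter.filter_not_empty G).
  refine (filter.filterS _ HA).
  intros n An; apply H; exists n; exact An.
- intro A; exact (filter.in_ultra_setVsetC A UG).
- intro N; apply sG; exists N; [exact I|].
  intros n Hn; exact (ssrbool.elimT ssrnat.leP Hn).
Qed.

Section Ultralimits.
Context (U : (nat -> Prop) -> Prop) (HU : free_ultrafilter U).

Lemma uf_mp (A B : nat -> Prop) : U A -> (forall n, A n -> B n) -> U B.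
Proof. intros HA HAB; exact (uf_sub U HU A B HAB HA). Qed.

Lemma uf_mp2 (A B C : nat -> Prop) :
  U A -> U B -> (forall n, A n -> B n -> C n) -> U C.
Proof.
intros HA HB H; apply (uf_mp _ _ (uf_and U HU _ _ HA HB)).
intros n [Hn1 Hn2]; auto.
Qed.

Lemma uf_all (A : nat -> Prop) : (forall n, A n) -> U A.
Proof. intro H; apply (uf_mp _ _ (uf_ge U HU 0)); auto. Qed.

Lemma uf_inv_small e : 0 < e -> U (fun n => / INR (n + 1) < e).
Proof.
intro He; destruct (archimed_cor1 e He) as [N [HN Npos]].
apply (uf_mp _ _ (uf_ge U HU N)); intros n Hn.
apply Rle_lt_trans with (2 := HN); apply Rinv_le_contravar.
- apply lt_0_INR; lia.
- apply le_INR; lia.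
Qed.

Definition ulim {X : Type} (d : X -> X -> R) (x : nat -> X) (l : X) : Prop :=
  forall e, 0 < e -> U (fun n => d (x n) l < e).

Lemma R_dist_metric : is_metric Rdist.
Proof.
constructor.
- intros; apply Rge_le, Rdist_pos.
- exact Rdist_refl.
- exact Rdist_sym.
- intros x y z; apply Rdist_tri.
Qed.

Section Metric.
Context (X : Type) (d : X -> X -> R) (Hd : is_metric d).

Lemma ulim_const (l : X) : ulim d (fun _ => l) l.
Proof.
intros e He; apply uf_all; intros _.
rewrite (proj2 (d_zero d Hd l l) eq_refl); exact He.
Qed.

Lemma ulim_dist_le (x y : nat -> X) (l m : X) (c : R) :
  ulim d x l -> ulim d y m -> U (fun n => d (x n) (y n) <= c) -> d l m <= c.
Proof.
intros Hx Hy Hc; destruct (Rle_or_lt (d l m) c) as [|Hlt]; [assumption|exfalso].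
assert (He : 0 < (d l m - c) / 2) by lra.
destruct (uf_ex U HU _ (uf_and U HU _ _ Hc (uf_and U HU _ _ (Hx _ He) (Hy _ He))))
  as [n [H1 [H2 H3]]].
pose proof (d_tri d Hd l (x n) m); pose proof (d_tri d Hd (x n) (y n) m).
rewrite (d_sym d Hd l (x n)) in *; lra.
Qed.

Lemma dist_le_0 (x y : X) : d x y <= 0 -> x = y.
Proof.
intro H; apply (d_zero d Hd); pose proof (d_nonneg d Hd x y); lra.
Qed.

Lemma ulim_eq (x y : nat -> X) (l m : X) :
  ulim d x l -> ulim d y m -> (forall e, 0 < e -> U (fun n => d (x n) (y n) < e)) ->
  l = m.
Proof.
intros Hx Hy H; apply dist_le_0, le_epsilon; intros e He.
rewrite Rplus_0_l; apply (ulim_dist_le x y); auto.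
apply (uf_mp _ _ (H e He)); intros; lra.
Qed.

Lemma ulim_unique (x : nat -> X) (l m : X) : ulim d x l -> ulim d x m -> l = m.
Proof.
intros Hx Hy; apply (ulim_eq x x); auto.
intros e He; apply uf_all; intro n.
rewrite (proj2 (d_zero d Hd _ _) eq_refl); exact He.
Qed.

Lemma ulim_near (x y : nat -> X) (l : X) :
  ulim d x l -> (forall e, 0 < e -> U (fun n => d (x n) (y n) < e)) -> ulim d y l.
Proof.
intros Hx H e He.
apply (uf_mp2 _ _ _ (Hx (e / 2) ltac:(lra)) (H (e / 2) ltac:(lra))).
intros n H1 H2; pose proof (d_tri d Hd (y n) (x n) l).
rewrite (d_sym d Hd (y n) (x n)) in *; lra.
Qed.

(** If no [A i] were in [U], all complements would be, and so would their finite intersection, which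
    is empty by hypothesis. *)
Lemma uf_list_union (I : Type) (A : I -> nat -> Prop) (l : list I) :
  (forall n, exists i, In i l /\ A i n) -> exists i, In i l /\ U (A i).
Proof.
intro H; apply NNPP; intro Hn.
assert (Hc : U (fun n => forall i, In i l -> ~ A i n)).
{ clear H; induction l as [|i l IH].
  - apply uf_all; intros n i [].
  - destruct (uf_or U HU (A i)) as [Hi|Hi].
    + exfalso; apply Hn; exists i; split; [left|]; auto.
    + assert (IH' : U (fun n => forall i, In i l -> ~ A i n)).
      { apply IH; intros [j [Hj1 Hj2]]; apply Hn; exists j; split; [right|]; auto. }
      apply (uf_mp2 _ _ _ Hi IH'); intros n H1 H2 j [<-|Hj]; auto. }
destruct (uf_ex U HU _ Hc) as [n Hn'].
destruct (H n) as [i [Hi1 Hi2]]; exact (Hn' i Hi1 Hi2).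
Qed.

(** A point that is not a limit has a ball missed by [U]-most terms. Finitely many such balls would
    cover [X], and one of them would then contain [U]-most terms. *)
Lemma ulim_compact : d_compact d -> forall x : nat -> X, exists l, ulim d x l.
Proof.
intros Hc x; apply NNPP; intro Hno.
assert (Hr : forall l, exists r, 0 < r /\ ~ U (fun n => d (x n) l < r)).
{ intro l; apply NNPP; intro H; apply Hno; exists l; intros e He.
  apply NNPP; intro H'; apply H; exists e; auto. }
apply choice in Hr; destruct Hr as [r Hr].
destruct (Hc X (fun l y => d y l < r l)) as [s Hs].
- intros l y Hy; exists (r l - d y l); split; [lra|]; intros z Hz.
  pose proof (d_tri d Hd z y l); rewrite (d_sym d Hd z y) in *; lra.
- intro l; exists l; rewrite (proj2 (d_zero d Hd l l) eq_refl); apply Hr.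
- destruct (uf_list_union X (fun l n => d (x n) l < r l) s) as [l [_ Hl]].
  + intro n; apply Hs.
  + exact (proj2 (Hr l) Hl).
Qed.

Context (phi : R -> X -> X) (Hphi : is_flow d phi).

Lemma ulim_flow (s : nat -> R) (x : nat -> X) (t : R) (l : X) :
  ulim Rdist s t -> ulim d x l -> ulim d (fun n => phi (s n) (x n)) (phi t l).
Proof.
intros Hs Hx e He; destruct (proj1 Hphi t l e He) as [del [Hdel H]].
apply (uf_mp2 _ _ _ (Hs del Hdel) (Hx del Hdel)); intros n H1 H2.
rewrite (d_sym d Hd); apply H; [exact H1|rewrite (d_sym d Hd); exact H2].
Qed.

End Metric.

(** The limit is the supremum of those [y] lying below [u n] for [U]-most [n]. *)
Lemma ulim_bounded (B : R) (u : nat -> R) :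
  U (fun n => Rabs (u n) <= B) -> exists l, ulim Rdist u l.
Proof.
intro HB.
set (E := fun y => U (fun n => y <= u n)).
destruct (completeness E) as [l [Hl1 Hl2]].
- exists B; intros y Hy.
  destruct (uf_ex U HU _ (uf_and U HU _ _ HB Hy)) as [n [H1 H2]].
  pose proof (Rle_abs (u n)); lra.
- exists (- B); apply (uf_mp _ _ HB); intros n Hn.
  pose proof (Rle_abs (- u n)); rewrite Rabs_Ropp in *; lra.
- exists l; intros e He.
  assert (H1 : U (fun n => l - e / 2 <= u n)).
  { apply NNPP; intro Hno.
    assert (l <= l - e / 2); [|lra].
    apply Hl2; intros y Hy; destruct (Rle_or_lt y (l - e / 2)); [assumption|].
    exfalso; apply Hno; apply (uf_mp _ _ Hy); intros; lra. }
  assert (H2 : U (fun n => ~ l + e / 2 <= u n)).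
  { destruct (uf_or U HU (fun n => l + e / 2 <= u n)) as [H|H]; [|exact H].
    pose proof (Hl1 _ H); lra. }
  apply (uf_mp2 _ _ _ H1 H2); intros n H3 H4; unfold Rdist; apply Rabs_def1; lra.
Qed.

Lemma ulim_minus (u v : nat -> R) (l m : R) :
  ulim Rdist u l -> ulim Rdist v m -> ulim Rdist (fun n => u n - v n) (l - m).
Proof.
intros Hu Hv e He.
apply (uf_mp2 _ _ _ (Hu (e / 2) ltac:(lra)) (Hv (e / 2) ltac:(lra))).
unfold Rdist; intros n H1 H2; apply Rabs_def2 in H1, H2; apply Rabs_def1; lra.
Qed.

Lemma ulim_le (u : nat -> R) (l c : R) :
  ulim Rdist u l -> U (fun n => u n <= c) -> l <= c.
Proof.
intros Hu Hc; apply le_epsilon; intros e He.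
destruct (uf_ex U HU _ (uf_and U HU _ _ Hc (Hu e He))) as [n [H1 H2]].
apply Rabs_def2 in H2; lra.
Qed.

Lemma ulim_ge (u : nat -> R) (l c : R) :
  ulim Rdist u l -> U (fun n => c <= u n) -> c <= l.
Proof.
intros Hu Hc; apply le_epsilon; intros e He.
destruct (uf_ex U HU _ (uf_and U HU _ _ Hc (Hu e He))) as [n [H1 H2]].
apply Rabs_def2 in H2; lra.
Qed.

End Ultralimits.

(** Entry point of the compactness arguments: a failing uniform bound yields bad data for every
    threshold [/ INR (n + 1)], whose ultralimit is then examined. *)
Lemma counterexample_seq (T : Type) (P : R -> T -> Prop) :
  ~ (exists del, 0 < del /\ forall x, P del x) ->
  exists x : nat -> T, forall n, ~ P (/ INR (n + 1)) (x n).
Proof.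
intro H; apply (choice (fun n x => ~ P (/ INR (n + 1)) x)); intro n.
apply NNPP; intro H'; apply H; exists (/ INR (n + 1)); split.
- apply Rinv_0_lt_compat, lt_0_INR; lia.
- intro x; apply NNPP; intro Hx; apply H'; exists x; exact Hx.
Qed.

(** * Uniform estimates for flows on compact spaces *)

Section Flow.
Context (X : Type) (d : X -> X -> R) (phi : R -> X -> X).
Context (Hd : is_metric d) (Hc : d_compact d) (Hphi : is_flow d phi).

Lemma flow_0 x : phi 0 x = x.
Proof. apply Hphi. Qed.

Lemma flow_add t s x : phi t (phi s x) = phi (s + t) x.
Proof. symmetry; apply Hphi. Qed.

Lemma metric_refl x : d x x = 0.
Proof. apply (d_zero d Hd); reflexivity. Qed.

(** Bad points [x n], [y n] would share an ultralimit [l] and bad times [t n], [s n] an ultralimit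
    [r]; both images then converge to [phi r l]. *)
Lemma flow_unif_continuous (B e : R) : 0 < e ->
  exists del, 0 < del /\ forall x y t s,
    Rabs t <= B -> Rabs (s - t) <= del -> d x y <= del ->
    d (phi t x) (phi s y) < e.
Proof.
intro He; apply NNPP; intro Hno.
destruct (counterexample_seq (X * X * R * R) (fun del p => let '(x, y, t, s) := p in
    Rabs t <= B -> Rabs (s - t) <= del -> d x y <= del ->
    d (phi t x) (phi s y) < e)) as [p Hp].
{ intros [del [H1 H2]]; apply Hno; exists del; split; [exact H1|].
  intros x y t s; exact (H2 (x, y, t, s)). }
destruct free_ultrafilter_exists as [U HU].
set (x := fun n => fst (fst (fst (p n)))); set (y := fun n => snd (fst (fst (p n)))).
set (t := fun n => snd (fst (p n))); set (s := fun n => snd (p n)).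
assert (H : forall n, Rabs (t n) <= B /\ Rabs (s n - t n) <= / INR (n + 1) /\
   d (x n) (y n) <= / INR (n + 1) /\ ~ d (phi (t n) (x n)) (phi (s n) (y n)) < e).
{ intro n; specialize (Hp n); unfold x, y, t, s.
  destruct (p n) as [[[x' y'] t'] s']; simpl.
  repeat split; apply NNPP; tauto. }
clearbody x y t s; clear p Hp.
destruct (ulim_compact U HU X d Hd Hc x) as [l Hl].
destruct (ulim_bounded U HU B t) as [r Hr]; [apply uf_all; auto; apply H|].
assert (Hl' : ulim U d y l).
{ apply (ulim_near U HU X d Hd x); auto; intros e' He'.
  apply (uf_mp U HU _ _ (uf_inv_small U HU e' He')); intros n Hn.
  destruct (H n) as (_ & _ & H' & _); lra. }
assert (Hr' : ulim U Rdist s r).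
{ apply (ulim_near U HU R Rdist R_dist_metric t); auto; intros e' He'.
  apply (uf_mp U HU _ _ (uf_inv_small U HU e' He')); intros n Hn.
  rewrite Rdist_sym; unfold Rdist; destruct (H n) as (_ & H' & _ & _); lra. }
pose proof (ulim_flow U HU X d Hd phi Hphi _ _ _ _ Hr Hl (e / 2) ltac:(lra)) as H1.
pose proof (ulim_flow U HU X d Hd phi Hphi _ _ _ _ Hr' Hl' (e / 2) ltac:(lra)) as H2.
destruct (uf_ex U HU _ (uf_and U HU _ _ H1 H2)) as [n [H3 H4]].
destruct (H n) as (_ & _ & _ & H5); apply H5.
pose proof (d_tri d Hd (phi (t n) (x n)) (phi r l) (phi (s n) (y n))).
rewrite (d_sym d Hd (phi r l)) in *; lra.
Qed.

Lemma flow_small_time (e : R) : 0 < e ->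
  exists a, 0 < a /\ forall x s, Rabs s <= a -> d x (phi s x) < e.
Proof.
intro He; destruct (flow_unif_continuous 0 e He) as [del [Hdel H]].
exists del; split; [exact Hdel|]; intros x s Hs.
rewrite <- (flow_0 x) at 1; apply H.
- rewrite Rabs_R0; lra.
- rewrite Rminus_0_r; exact Hs.
- rewrite metric_refl; lra.
Qed.

Lemma flow_period_mult (T : R) (x : X) : phi T x = x -> forall k : Z, phi (IZR k * T) x = x.
Proof.
intro H.
assert (Hn : forall n : nat, phi (INR n * T) x = x).
{ induction n as [|n IH].
  - simpl; rewrite Rmult_0_l; apply flow_0.
  - rewrite S_INR, Rmult_plus_distr_r, Rmult_1_l, <- flow_add, IH; exact H. }
intro k; destruct (Z_le_gt_dec 0 k) as [Hk|Hk].
- rewrite <- (Z2Nat.id k Hk), <- INR_IZR_INZ; apply Hn.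
- rewrite <- (Hn (Z.to_nat (- k))) at 1.
  rewrite flow_add, INR_IZR_INZ, Z2Nat.id by lia.
  rewrite <- (flow_0 x) at 2; f_equal; rewrite opp_IZR; ring.
Qed.

(** Were there nonzero periods [s n] shrinking to 0, their integer multiples would approximate any
    [t], so the limit of the points [x n] would be fixed by every [phi t]. *)
Lemma no_short_period : regular_flow phi ->
  exists T0, 0 < T0 /\ forall s x, 0 < Rabs s <= T0 -> phi s x <> x.
Proof.
intro Hreg; apply NNPP; intro Hno.
destruct (counterexample_seq (R * X) (fun T0 p =>
  0 < Rabs (fst p) <= T0 -> phi (fst p) (snd p) <> snd p)) as [p Hp].
{ intros [T0 [H1 H2]]; apply Hno; exists T0; split; [exact H1|].
  intros s x; exact (H2 (s, x)). }
destruct free_ultrafilter_exists as [U HU].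
set (s := fun n => fst (p n)); set (x := fun n => snd (p n)).
assert (H : forall n, 0 < Rabs (s n) <= / INR (n + 1) /\ phi (s n) (x n) = x n).
{ intro n; specialize (Hp n); fold (s n) (x n) in Hp.
  split; apply NNPP; tauto. }
destruct (ulim_compact U HU X d Hd Hc x) as [l Hl].
apply Hreg; exists l; intro t.
assert (Hk : forall n, exists k : Z, Rabs (IZR k * s n - t) <= Rabs (s n)).
{ intro n; destruct (H n) as [[Hs _] _].
  assert (s n <> 0) by (intro H0; rewrite H0, Rabs_R0 in Hs; lra).
  exists (up (t / s n)).
  replace (IZR (up (t / s n)) * s n - t) with ((IZR (up (t / s n)) - t / s n) * s n)
    by (field; assumption).
  rewrite Rabs_mult; rewrite <- (Rmult_1_l (Rabs (s n))) at 2.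
  apply Rmult_le_compat_r; [apply Rabs_pos|].
  destruct (archimed (t / s n)); rewrite Rabs_pos_eq; lra. }
apply choice in Hk; destruct Hk as [k Hk].
assert (Ht : ulim U Rdist (fun n => IZR (k n) * s n) t).
{ intros e He; apply (uf_mp U HU _ _ (uf_inv_small U HU e He)); intros n Hn.
  unfold Rdist; specialize (Hk n); destruct (H n) as [[_ H'] _]; lra. }
apply (ulim_eq U HU X d Hd _ _ _ _ (ulim_flow U HU X d Hd phi Hphi _ _ _ _ Ht Hl) Hl).
intros e He; apply (uf_all U HU); intro n.
rewrite flow_period_mult by apply H; rewrite metric_refl; exact He.
Qed.

(** Quantitative absence of short periods, uniform in the starting point: within time [T0], a small
    displacement can only come from a small time. *)
Definition injectivity_time (T0 : R) : Prop :=
  forall e, 0 < e -> exists eta, 0 < eta /\ forall s x,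
    Rabs s <= T0 -> d x (phi s x) <= eta -> Rabs s < e.

Lemma injectivity_time_exists : regular_flow phi ->
  exists T0, 0 < T0 <= 1 /\ injectivity_time T0.
Proof.
intro Hreg; destruct (no_short_period Hreg) as [T1 [HT1 Hper]].
assert (HT0 : exists T0, 0 < T0 <= 1 /\ T0 <= T1).
{ exists (Rmin T1 1); pose proof (Rmin_l T1 1); pose proof (Rmin_r T1 1).
  repeat split; auto; apply Rmin_glb_lt; lra. }
destruct HT0 as [T0 [HT0 HT01]]; exists T0; split; [exact HT0|].
intros e He; apply NNPP; intro Hno.
destruct (counterexample_seq (R * X) (fun eta p =>
  Rabs (fst p) <= T0 -> d (snd p) (phi (fst p) (snd p)) <= eta -> Rabs (fst p) < e))
  as [p Hp].
{ intros [eta [H1 H2]]; apply Hno; exists eta; split; [exact H1|].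
  intros s x; exact (H2 (s, x)). }
destruct free_ultrafilter_exists as [U HU].
set (s := fun n => fst (p n)); set (x := fun n => snd (p n)).
assert (H : forall n, Rabs (s n) <= T0 /\ d (x n) (phi (s n) (x n)) <= / INR (n + 1)
  /\ e <= Rabs (s n)).
{ intro n; specialize (Hp n); fold (s n) (x n) in Hp.
  repeat split; [apply NNPP; tauto|apply NNPP; tauto|].
  apply Rnot_lt_le; tauto. }
destruct (ulim_compact U HU X d Hd Hc x) as [l Hl].
destruct (ulim_bounded U HU T0 s) as [r Hr]; [apply (uf_all U HU); apply H|].
assert (Hr0 : ulim U Rdist (fun n => Rabs (s n)) (Rabs r)).
{ intros e' He'; apply (uf_mp U HU _ _ (Hr e' He')); intros n Hn; unfold Rdist in *.
  pose proof (Rabs_triang_inv2 (s n) r); lra. }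
apply (Hper r l).
- split.
  + apply Rlt_le_trans with e; [exact He|].
    apply (ulim_ge U HU _ _ _ Hr0), (uf_all U HU); apply H.
  + apply Rle_trans with T0; [|exact HT01].
    apply (ulim_le U HU _ _ _ Hr0), (uf_all U HU); apply H.
- symmetry.
  apply (ulim_eq U HU X d Hd _ _ _ _ Hl (ulim_flow U HU X d Hd phi Hphi _ _ _ _ Hr Hl)).
  intros e' He'; apply (uf_mp U HU _ _ (uf_inv_small U HU e' He')); intros n Hn.
  destruct (H n) as (_ & H' & _); lra.
Qed.

(** Both [phi s y] and [phi v y] are close to [phi s x], the first by uniform continuity, so the
    time between them is small. This converts closeness of orbits into control of time
    distortion. *)
Lemma time_lag_small (T0 e : R) : injectivity_time T0 -> 0 < e ->
  exists eta, 0 < eta /\ forall x y s v,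
    Rabs s <= 1 -> Rabs (v - s) <= T0 ->
    d x y <= eta -> d (phi s x) (phi v y) <= eta -> Rabs (v - s) < e.
Proof.
intros HT0 He; destruct (HT0 e He) as [eta [Heta H]].
destruct (flow_unif_continuous 1 (eta / 2) ltac:(lra)) as [del [Hdel Huc]].
exists (Rmin del (eta / 2)).
pose proof (Rmin_l del (eta / 2)); pose proof (Rmin_r del (eta / 2)).
split; [apply Rmin_glb_lt; lra|].
intros x y s v Hs Hv Hxy Hsv; apply (H (v - s) (phi s y)); [exact Hv|].
rewrite flow_add; replace (s + (v - s)) with v by ring.
assert (Hxy' : d (phi s x) (phi s y) < eta / 2).
{ apply Huc; [exact Hs| |lra].
  unfold Rminus; rewrite Rplus_opp_r, Rabs_R0; lra. }
pose proof (d_tri d Hd (phi s y) (phi s x) (phi v y)).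
rewrite (d_sym d Hd (phi s y) (phi s x)) in *; lra.
Qed.

End Flow.

(** * Reparametrizations and integer-indexed time sequences *)

Lemma continuity_of_lipschitz (f : R -> R) (C : R) : 0 < C ->
  (forall s t, Rabs (f s - f t) <= C * Rabs (s - t)) -> continuity f.
Proof.
intros HC H x e He; exists (e / C); split; [apply Rdiv_lt_0_compat; lra|].
simpl; unfold Rdist; intros y [_ Hy].
apply Rle_lt_trans with (1 := H y x).
replace e with (C * (e / C)) by (field; lra).
apply Rmult_lt_compat_l; assumption.
Qed.

(** The lower slope [c] makes [f] unbounded both ways, hence onto by the intermediate value theorem,
    and makes the inverse Lipschitz with constant [/ c]. *)
Lemma Rep_of_bilipschitz (f : R -> R) (c C : R) : 0 < c -> f 0 = 0 ->
  (forall s t, s <= t -> c * (t - s) <= f t - f s <= C * (t - s)) -> Rep f.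
Proof.
intros Hc Hf0 H.
assert (HC : 0 < C) by (specialize (H 0 1 ltac:(lra)); lra).
assert (Hinc : forall s t, s < t -> f s < f t).
{ intros s t Hst; specialize (H s t ltac:(lra)).
  assert (0 < c * (t - s)) by (apply Rmult_lt_0_compat; lra); lra. }
assert (Habs : forall s t, c * Rabs (s - t) <= Rabs (f s - f t) <= C * Rabs (s - t)).
{ assert (Hle : forall s t, s <= t ->
    c * Rabs (s - t) <= Rabs (f s - f t) <= C * Rabs (s - t)).
  { intros s t Hst; specialize (H s t Hst).
    assert (0 <= c * (t - s)) by (apply Rmult_le_pos; lra).
    rewrite (Rabs_left1 (s - t)), (Rabs_left1 (f s - f t)) by lra; lra. }
  intros s t; destruct (Rle_or_lt s t); [auto|].
  rewrite (Rabs_minus_sym s t), (Rabs_minus_sym (f s)); apply Hle; lra. }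
assert (Hcont : continuity f).
{ apply (continuity_of_lipschitz f C HC); intros; apply Habs. }
assert (Hsurj : forall y, exists t, f t = y).
{ intro y; set (B := (Rabs y + 1) / c).
  assert (HB : 0 < B) by (pose proof (Rabs_pos y); apply Rdiv_lt_0_compat; lra).
  assert (HcB : c * B = Rabs y + 1) by (unfold B; field; lra).
  pose proof (H 0 B ltac:(lra)) as H1; pose proof (H (- B) 0 ltac:(lra)) as H2.
  pose proof (Rle_abs y); pose proof (Rle_abs (- y)); rewrite Rabs_Ropp in *.
  destruct (IVT (fun t => f t - y) (- B) B) as [t [_ Ht]].
  - apply continuity_minus; [exact Hcont|apply continuity_const; intros ? ?; reflexivity].
  - lra.
  - lra.
  - lra.
  - exists t; lra. }
apply choice in Hsurj; destruct Hsurj as [g Hg].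
split; [exact Hinc|split; [exact Hcont|split; [|exact Hf0]]].
exists g; split; [|split; [exact Hg|]].
- intro t; destruct (Rtotal_order (g (f t)) t) as [Hlt|[Heq|Hgt]]; [|exact Heq|].
  + apply Hinc in Hlt; rewrite Hg in Hlt; lra.
  + apply Hinc in Hgt; rewrite Hg in Hgt; lra.
- apply (continuity_of_lipschitz g (/ c)); [apply Rinv_0_lt_compat, Hc|].
  intros s t; destruct (Habs (g s) (g t)) as [H1 _]; rewrite !Hg in H1.
  apply Rmult_le_reg_l with c; [exact Hc|].
  rewrite <- Rmult_assoc, Rinv_r, Rmult_1_l by lra; exact H1.
Qed.

Lemma Rep_inv (h : R -> R) : Rep h ->
  exists g, Rep g /\ (forall t, g (h t) = t) /\ (forall t, h (g t) = t).
Proof.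
intros (Hinc & Hcont & (g & Hgh & Hhg & Hg) & H0).
exists g; split; [|split; assumption].
split; [|split; [exact Hg|split]].
- intros s t Hst; destruct (Rlt_or_le (g s) (g t)) as [|Hle]; [assumption|exfalso].
  destruct Hle as [Hlt|Heq].
  + apply Hinc in Hlt; rewrite !Hhg in Hlt; lra.
  + apply (f_equal h) in Heq; rewrite !Hhg in Heq; lra.
- exists h; auto.
- rewrite <- H0 at 1; apply Hgh.
Qed.

Lemma Rep_comp (f h : R -> R) : Rep f -> Rep h -> Rep (fun t => f (h t)).
Proof.
intros (Hf1 & Hf2 & (f' & Hf3 & Hf4 & Hf5) & Hf6) (Hh1 & Hh2 & (h' & Hh3 & Hh4 & Hh5) & Hh6).
split; [auto|split; [|split]].
- exact (continuity_comp h f Hh2 Hf2).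
- exists (fun t => h' (f' t)); repeat split.
  + intro t; rewrite Hf3; apply Hh3.
  + intro t; rewrite Hh4; apply Hf4.
  + exact (continuity_comp f' h' Hf5 Hh5).
- rewrite Hh6; exact Hf6.
Qed.

(** The bounds are closed, so they survive limits; the lower one is positive for [a > 0], so
    interpolation gives a homeomorphism; the margin [a / 2] around [a] absorbs the errors of the
    shadowing construction. *)
Definition coarse_step (a s : R) : Prop := a / 2 <= s <= 3 * a / 2.

Definition coarse (a : R) (w : Z -> R) : Prop :=
  w 0%Z = 0 /\ forall k, coarse_step a (w (k + 1)%Z - w k).

Lemma coarse_diff (a : R) (w : Z -> R) (i j : Z) : (i <= j)%Z ->
  (forall k, (i <= k < j)%Z -> coarse_step a (w (k + 1)%Z - w k)) ->
  a / 2 * (IZR j - IZR i) <= w j - w i <= 3 * a / 2 * (IZR j - IZR i).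
Proof.
intros Hij; pattern j; apply Zlt_lower_bound_ind with (z := i); [|exact Hij].
clear j Hij; intros j IH Hij H.
destruct (Z.eq_dec i j) as [->|Hne]; [lra|].
specialize (IH (j - 1)%Z ltac:(lia)).
assert (H' := H (j - 1)%Z ltac:(lia)); unfold coarse_step in H'.
replace (j - 1 + 1)%Z with j in H' by ring.
rewrite minus_IZR in IH.
assert (IH' := IH ltac:(intros k Hk; apply H; lia)).
lra.
Qed.

Definition interp (w : Z -> R) (t : R) : R :=
  w (Int_part t) + (t - IZR (Int_part t)) * (w (Int_part t + 1)%Z - w (Int_part t)).

Lemma Int_part_IZR_le (t : R) : 0 <= t - IZR (Int_part t) <= 1.
Proof. destruct (base_Int_part t); lra. Qed.

Lemma interp_near (a : R) (w : Z -> R) (t : R) : 0 < a -> coarse a w ->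
  Rabs (interp w t - w (Int_part t)) <= 2 * a.
Proof.
intros Ha [_ Hw]; unfold interp; specialize (Hw (Int_part t)); unfold coarse_step in Hw.
pose proof (Int_part_IZR_le t).
apply Rabs_le; split; nra.
Qed.

Lemma Rep_interp (a : R) (w : Z -> R) : 0 < a -> coarse a w -> Rep (interp w).
Proof.
intros Ha Hw.
apply Rep_of_bilipschitz with (a / 2) (3 * a / 2); [lra| |].
- unfold interp.
  assert (H0 : Int_part 0 = 0%Z) by (symmetry; apply Int_part_spec; simpl; lra).
  rewrite H0, (proj1 Hw); simpl; ring.
- intros s t Hst; unfold interp.
  pose proof (Int_part_IZR_le s) as Hs; pose proof (Int_part_IZR_le t) as Ht.
  destruct (base_Int_part s) as [_ Hs']; destruct (base_Int_part t) as [_ Ht'].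
  set (i := Int_part s) in *; set (j := Int_part t) in *.
  assert (Hij : (i <= j)%Z).
  { assert (i < j + 1)%Z; [|lia]; apply lt_IZR; rewrite plus_IZR; lra. }
  destruct Hw as [_ Hw].
  pose proof (Hw i) as Hwi; pose proof (Hw j) as Hwj; unfold coarse_step in *.
  destruct (Z.eq_dec i j) as [<-|Hne].
  + set (p := w (i + 1)%Z - w i) in *.
    replace (w i + (t - IZR i) * p - (w i + (s - IZR i) * p)) with (p * (t - s)) by ring.
    split; apply Rmult_le_compat_r; lra.
  + pose proof (coarse_diff a w (i + 1) j ltac:(lia) (fun k _ => Hw k)) as Hd.
    rewrite plus_IZR in Hd.
    set (p := w (i + 1)%Z - w i) in *; set (q := w (j + 1)%Z - w j) in *.
    assert (w (i + 1)%Z = w i + p) by (unfold p; ring).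
    assert (a / 2 * (IZR i + 1 - s) <= p * (IZR i + 1 - s) <= 3 * a / 2 * (IZR i + 1 - s))
      by (split; apply Rmult_le_compat_r; lra).
    assert (a / 2 * (t - IZR j) <= q * (t - IZR j) <= 3 * a / 2 * (t - IZR j))
      by (split; apply Rmult_le_compat_r; lra).
    lra.
Qed.

Section CoarseLimit.
Context (a : R) (Ha : 0 < a) (U : (nat -> Prop) -> Prop) (HU : free_ultrafilter U).

Lemma ulim_coarse_step (u v : nat -> R) (l m : R) :
  ulim U Rdist u l -> ulim U Rdist v m -> U (fun n => coarse_step a (v n - u n)) ->
  coarse_step a (m - l).
Proof.
intros Hu Hv H; pose proof (ulim_minus U HU _ _ _ _ Hv Hu) as Hvu; split.
- apply (ulim_ge U HU _ _ _ Hvu), (uf_mp U HU _ _ H); intros n []; assumption.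
- apply (ulim_le U HU _ _ _ Hvu), (uf_mp U HU _ _ H); intros n []; assumption.
Qed.

(** Coarse steps from the origin confine [v n k] to a bounded interval for [U]-most [n], so all
    indices converge along the same ultrafilter. *)
Lemma ulim_coarse (v : nat -> Z -> R) :
  (forall n, v n 0%Z = 0) ->
  (forall K : nat, U (fun n => forall k, (- Z.of_nat K <= k < Z.of_nat K)%Z ->
     coarse_step a (v n (k + 1)%Z - v n k))) ->
  exists w, coarse a w /\ forall k, ulim U Rdist (fun n => v n k) (w k).
Proof.
intros H0 H1.
assert (Hw : forall k, exists r, ulim U Rdist (fun n => v n k) r).
{ intro k; apply (ulim_bounded U HU (3 * a / 2 * Rabs (IZR k))).
  apply (uf_mp U HU _ _ (H1 (Z.abs_nat k))); intros n Hn.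
  destruct (Z_le_gt_dec 0 k) as [Hk|Hk].
  - pose proof (coarse_diff a (v n) 0 k ltac:(lia) ltac:(intros; apply Hn; lia)) as Hb.
    rewrite H0 in Hb; apply IZR_le in Hk.
    rewrite (Rabs_pos_eq (IZR k)) by exact Hk; apply Rabs_le; split; [|lra].
    assert (0 <= a / 2 * IZR k) by (apply Rmult_le_pos; lra).
    assert (0 <= 3 * a / 2 * IZR k) by (apply Rmult_le_pos; lra); lra.
  - pose proof (coarse_diff a (v n) k 0 ltac:(lia) ltac:(intros; apply Hn; lia)) as Hb.
    rewrite H0 in Hb; assert (Hk' := IZR_le k 0 ltac:(lia)).
    rewrite (Rabs_left1 (IZR k)) by exact Hk'; apply Rabs_le; split; [lra|].
    assert (0 <= a / 2 * - IZR k) by (apply Rmult_le_pos; lra).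
    assert (0 <= 3 * a / 2 * - IZR k) by (apply Rmult_le_pos; lra); lra. }
apply choice in Hw; destruct Hw as [w Hw]; exists w; split; [split|exact Hw].
- apply (ulim_unique U HU R Rdist R_dist_metric _ _ _ (Hw 0%Z)).
  intros e He; apply (uf_all U HU); intro n.
  rewrite H0, Rdist_eq; exact He.
- intro k; apply (ulim_coarse_step _ _ _ _ (Hw k) (Hw (k + 1)%Z)).
  (* The window omits its right end, so its radius must exceed [|k|] by one. *)
  apply (uf_mp U HU _ _ (H1 (S (Z.abs_nat k)))); intros n Hn; apply Hn; lia.
Qed.

End CoarseLimit.

(** * Expansiveness for time sequences and its uniform version *)

Section Expansive.
Context (X : Type) (d : X -> X -> R) (phi : R -> X -> X).
Context (Hd : is_metric d) (Hc : d_compact d) (Hphi : is_flow d phi).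
Context (eps del a : R) (Ha : 0 < a).
Context (Hdel : forall x y h, Rep h ->
  (forall t, d (phi t x) (phi (h t) y) <= del) ->
  exists s, - eps <= s <= eps /\ y = phi s x).
Context (Hosc : forall x s, Rabs s <= 2 * a -> d x (phi s x) < del / 4).

(** The reparametrization is [interp v] after the inverse of [interp u]. Closeness [del / 2] at
    integer indices and two oscillations below [del / 4] between them add up to at most [del]. *)
Lemma expansive_coarse (u v : Z -> R) (x y : X) :
  coarse a u -> coarse a v ->
  (forall k, d (phi (u k) x) (phi (v k) y) <= del / 2) ->
  exists s, - eps <= s <= eps /\ y = phi s x.
Proof.
intros Hu Hv H.
destruct (Rep_inv _ (Rep_interp a u Ha Hu)) as [g (Hg & _ & Hug)].
apply (Hdel x y (fun t => interp v (g t))).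
- apply Rep_comp; [apply (Rep_interp a)|]; assumption.
- intro t; rewrite <- (Hug t) at 1; generalize (g t); clear t; intro t.
  assert (Hnear : forall w z, coarse a w ->
    d (phi (w (Int_part t)) z) (phi (interp w t) z) < del / 4).
  { intros w z Hw.
    replace (interp w t) with (w (Int_part t) + (interp w t - w (Int_part t))) by ring.
    rewrite <- (flow_add X d phi Hphi); apply Hosc, interp_near; assumption. }
  pose proof (Hnear u x Hu); pose proof (Hnear v y Hv); specialize (H (Int_part t)).
  pose proof (d_tri d Hd (phi (interp u t) x) (phi (u (Int_part t)) x) (phi (interp v t) y)).
  pose proof (d_tri d Hd (phi (u (Int_part t)) x) (phi (v (Int_part t)) y) (phi (interp v t) y)).
  rewrite (d_sym d Hd (phi (interp u t) x) (phi (u (Int_part t)) x)) in *; lra.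
Qed.

Lemma coarse_multiples : coarse a (fun k => IZR k * a).
Proof.
split; [simpl; ring|]; intro k; rewrite plus_IZR; unfold coarse_step; lra.
Qed.

(** Counterexamples on growing windows have an ultralimit: two points whose full orbits stay close
    along a coarse sequence. Expansiveness puts these on one orbit, so for [U]-most windows the
    original points are close up to a shift, a contradiction. *)
Lemma expansive_uniform (rho : R) : 0 < rho ->
  exists n : nat, forall (x y : X) (v : Z -> R), v 0%Z = 0 ->
    (forall k, (- Z.of_nat n <= k < Z.of_nat n)%Z -> coarse_step a (v (k + 1)%Z - v k)) ->
    (forall k, (- Z.of_nat n <= k <= Z.of_nat n)%Z ->
       d (phi (IZR k * a) x) (phi (v k) y) <= del / 2) ->
    exists s, Rabs s <= eps /\ d x (phi s y) < rho.
Proof.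
intro Hrho; apply NNPP; intro Hno.
assert (Hseq : forall n : nat, exists p : X * X * (Z -> R),
  let '(x, y, v) := p in v 0%Z = 0 /\
    (forall k, (- Z.of_nat n <= k < Z.of_nat n)%Z -> coarse_step a (v (k + 1)%Z - v k)) /\
    (forall k, (- Z.of_nat n <= k <= Z.of_nat n)%Z ->
       d (phi (IZR k * a) x) (phi (v k) y) <= del / 2) /\
    ~ exists s, Rabs s <= eps /\ d x (phi s y) < rho).
{ intro n; apply NNPP; intro H; apply Hno; exists n; intros x y v H0 H1 H2.
  apply NNPP; intro H3; apply H; exists (x, y, v); auto. }
apply choice in Hseq; destruct Hseq as [p Hp].
destruct free_ultrafilter_exists as [U HU].
set (x := fun n => fst (fst (p n))); set (y := fun n => snd (fst (p n))).
set (v := fun n => snd (p n)).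
assert (H : forall n : nat, v n 0%Z = 0 /\
    (forall k, (- Z.of_nat n <= k < Z.of_nat n)%Z ->
       coarse_step a (v n (k + 1)%Z - v n k)) /\
    (forall k, (- Z.of_nat n <= k <= Z.of_nat n)%Z ->
       d (phi (IZR k * a) (x n)) (phi (v n k) (y n)) <= del / 2) /\
    ~ exists s, Rabs s <= eps /\ d (x n) (phi s (y n)) < rho).
{ intro n; specialize (Hp n); unfold x, y, v; destruct (p n) as [[x' y'] v']; exact Hp. }
clearbody x y v; clear p Hp.
destruct (ulim_compact U HU X d Hd Hc x) as [lx Hx].
destruct (ulim_compact U HU X d Hd Hc y) as [ly Hy].
destruct (ulim_coarse a Ha U HU v) as [w [Hw1 Hw2]].
{ intro n; apply H. }
{ intro K; apply (uf_mp U HU _ _ (uf_ge U HU K)); intros n Hn k Hk; apply H; lia. }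
destruct (expansive_coarse (fun k => IZR k * a) w lx ly coarse_multiples Hw1) as [s [Hs1 Hs2]].
- intro k.
  apply (ulim_dist_le U HU X d Hd (fun n => phi (IZR k * a) (x n)) (fun n => phi (v n k) (y n))).
  + apply (ulim_flow U HU X d Hd phi Hphi); [|exact Hx].
    apply (ulim_const U HU R Rdist R_dist_metric).
  + apply (ulim_flow U HU X d Hd phi Hphi); [apply Hw2|exact Hy].
  + apply (uf_mp U HU _ _ (uf_ge U HU (Z.abs_nat k))); intros n Hn; apply H; lia.
- assert (Hy' : ulim U d (fun n => phi (- s) (y n)) lx).
  { replace lx with (phi (- s) ly).
    - apply (ulim_flow U HU X d Hd phi Hphi); [|exact Hy].
      apply (ulim_const U HU R Rdist R_dist_metric).
    - rewrite Hs2, (flow_add X d phi Hphi), Rplus_opp_r; apply Hphi. }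
  destruct (uf_ex U HU _ (uf_and U HU _ _ (Hx (rho / 2) ltac:(lra)) (Hy' (rho / 2) ltac:(lra))))
    as [n [Hn1 Hn2]].
  destruct (H n) as (_ & _ & _ & Hn); apply Hn; exists (- s); split.
  + apply Rabs_le; lra.
  + pose proof (d_tri d Hd (x n) lx (phi (- s) (y n))).
    rewrite (d_sym d Hd lx) in *; lra.
Qed.

End Expansive.

Lemma Rabs_le_inv (x y : R) : Rabs x <= y -> - y <= x <= y.
Proof.
intro H; pose proof (Rle_abs x); pose proof (Rle_abs (- x)); rewrite Rabs_Ropp in *; lra.
Qed.

(** * Far returns of the orbit of a spiral point *)

Section Spiral.
Context (X : Type) (d : X -> X -> R) (phi : R -> X -> X).
Context (Hd : is_metric d) (Hc : d_compact d) (Hphi : is_flow d phi) (x0 : X).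

(** The inequality is weak so that the identity serves as the shift by 0, from which the iteration
    starts. *)
Definition asymptotic_shift (L : R) (g : R -> R) : Prop :=
  continuity g /\ (forall t, 0 <= t -> t + L <= g t) /\
  (forall e, 0 < e -> exists T, forall t, t >= T -> d (phi t x0) (phi (g t) x0) < e).

Lemma asymptotic_shift_iter (tau : R) (g : R -> R) : 0 <= tau -> asymptotic_shift tau g ->
  forall K : nat, exists gK, asymptotic_shift (INR K * tau) gK.
Proof.
intros Htau (Hg1 & Hg2 & Hg3); induction K as [|K (gK & IH1 & IH2 & IH3)].
- exists (fun t => t); split; [|split].
  + apply derivable_continuous, derivable_id.
  + intros t Ht; simpl; lra.
  + intros e He; exists 0; intros t Ht; rewrite (metric_refl X d Hd); exact He.
- assert (HK : 0 <= INR K * tau) by (apply Rmult_le_pos; [apply pos_INR|exact Htau]).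
  exists (fun t => g (gK t)); split; [|split].
  + exact (continuity_comp gK g IH1 Hg1).
  + intros t Ht; specialize (IH2 t Ht); specialize (Hg2 (gK t) ltac:(lra)).
    rewrite S_INR; lra.
  + intros e He.
    destruct (Hg3 (e / 2) ltac:(lra)) as [T1 HT1]; destruct (IH3 (e / 2) ltac:(lra)) as [T2 HT2].
    exists (Rmax 0 (Rmax T1 T2)); intros t Ht.
    pose proof (Rmax_l 0 (Rmax T1 T2)); pose proof (Rmax_r 0 (Rmax T1 T2)).
    pose proof (Rmax_l T1 T2); pose proof (Rmax_r T1 T2).
    specialize (IH2 t ltac:(lra)); specialize (HT1 (gK t) ltac:(lra)).
    specialize (HT2 t ltac:(lra)).
    pose proof (d_tri d Hd (phi t x0) (phi (gK t) x0) (phi (g (gK t)) x0)); lra.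
Qed.

Lemma spiral_far_shift (L : R) : spiral_point d phi x0 -> exists g, asymptotic_shift L g.
Proof.
intros (tau & Htau & g & Hg1 & Hg2 & Hg3).
destruct (INR_unbounded (L / tau)) as [K HK].
destruct (asymptotic_shift_iter tau g) with (K := K) as (gK & H1 & H2 & H3).
- lra.
- split; [exact Hg1|split; [|exact Hg3]]; intros t Ht; specialize (Hg2 t Ht); lra.
- exists gK; split; [exact H1|split; [|exact H3]].
  intros t Ht; specialize (H2 t Ht).
  assert (L < INR K * tau); [|lra].
  replace L with (L / tau * tau) by (field; lra).
  apply Rmult_lt_compat_r; assumption.
Qed.

(** The time lag estimate bounds the drift [|G (t + s) - G t - s|] by [e] only where it is at most
    [T0]. Continuity of [G] does the rest: the drift starts at 0, and to reach a larger value it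
    would have to take the value [e <= T0]. *)
Lemma spiral_return (T0 e r L : R) : injectivity_time X d phi T0 ->
  0 < e <= T0 -> 0 < r -> spiral_point d phi x0 ->
  exists T G, forall t, T <= t ->
    t + L <= G t /\ d (phi t x0) (phi (G t) x0) <= r /\
    forall s, 0 <= s <= 1 -> Rabs (G (t + s) - G t - s) < e.
Proof.
intros HT0 He Hr Hsp.
destruct (spiral_far_shift L Hsp) as (G & HG1 & HG2 & HG3).
destruct (time_lag_small X d phi Hd Hc Hphi T0 e HT0 ltac:(lra)) as (eta & Heta & Hlag).
destruct (HG3 (Rmin r eta)) as [T HT]; [apply Rmin_glb_lt; lra|].
pose proof (Rmin_l r eta); pose proof (Rmin_r r eta).
pose proof (Rmax_l 0 T); pose proof (Rmax_r 0 T).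
exists (Rmax 0 T), G; intros t Ht; split; [apply HG2; lra|split].
{ specialize (HT t ltac:(lra)); lra. }
intros s Hs; apply Rnot_le_lt; intro Hle.
set (V := fun s => Rabs (G (t + s) - G t - s)).
destruct (IVT_cor (fun s => V s - e) 0 s) as [s' [Hs' HV]].
- apply continuity_minus; [|apply continuity_const; intros ? ?; reflexivity].
  apply (continuity_comp (fun s => G (t + s) - G t - s) Rabs); [|exact Rcontinuity_abs].
  apply continuity_minus; [|apply derivable_continuous, derivable_id].
  apply continuity_minus; [|apply continuity_const; intros ? ?; reflexivity].
  apply (continuity_comp (fun s => t + s) G); [|exact HG1].
  apply continuity_plus; [|apply derivable_continuous, derivable_id].
  apply continuity_const; intros ? ?; reflexivity.
- lra.
- fold (V s) in Hle.
  assert (HV0 : V 0 = 0) by (unfold V; rewrite Rplus_0_r, Rminus_diag, Rminus_0_r; apply Rabs_R0).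
  cbv beta; rewrite HV0.
  assert (0 <= e * (V s - e)) by (apply Rmult_le_pos; lra); lra.
- assert (Hlt : V s' < e); [|cbv beta in HV; lra].
  apply (Hlag (phi t x0) (phi (G t) x0) s' (G (t + s') - G t)).
  + rewrite Rabs_pos_eq; lra.
  + fold (V s'); cbv beta in HV; lra.
  + specialize (HT t ltac:(lra)); lra.
  + rewrite !(flow_add X d phi Hphi).
    replace (G t + (G (t + s') - G t)) with (G (t + s')) by ring.
    specialize (HT (t + s') ltac:(lra)); lra.
Qed.

(** The maps to come are built by choice and may jump; the second clause controls them over steps of
    length at most [a]. *)
Definition shadows (T a r : R) (f : R -> R) : Prop :=
  (forall t, T <= t -> d (phi t x0) (phi (f t) x0) <= r) /\
  (forall t s, T <= t -> 0 <= s <= a -> Rabs (f (t + s) - f t - s) <= a / 4).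

(** * Shadowing the forward orbit by its later parts, turn by turn *)

Section Shadowing.
Context (T0 eps del a r T : R) (n : nat) (G : R -> R).
Context (HT0 : T0 <= 1) (Heps : eps = T0 / 8) (Ha : 0 < a <= T0 / 8) (Hr : 0 < r <= del / 2).
Context (Hlag : forall x y s v, Rabs s <= 1 -> Rabs (v - s) <= T0 ->
  d x y <= r -> d (phi s x) (phi v y) <= r -> Rabs (v - s) < a / 8).
Context (Hunif : forall (x y : X) (v : Z -> R), v 0%Z = 0 ->
  (forall k, (- Z.of_nat n <= k < Z.of_nat n)%Z -> coarse_step a (v (k + 1)%Z - v k)) ->
  (forall k, (- Z.of_nat n <= k <= Z.of_nat n)%Z ->
     d (phi (IZR k * a) x) (phi (v k) y) <= del / 2) ->
  exists s, Rabs s <= eps /\ d x (phi s y) < r / 2).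
Context (HG : forall t, T <= t ->
    t + (1 + INR n * a) <= G t /\ d (phi t x0) (phi (G t) x0) <= r / 2 /\
    forall s, 0 <= s <= 1 -> Rabs (G (t + s) - G t - s) < a / 8).

Lemma shadows_id : shadows T a r (fun t => t).
Proof.
split.
- intros t _; rewrite (metric_refl X d Hd); lra.
- intros t s _ Hs; replace (t + s - t - s) with 0 by ring; rewrite Rabs_R0; lra.
Qed.

(** Since [t - n a >= T], the samples of [f] around [t] form a coarse sequence on the whole window,
    and uniform expansiveness upgrades [r] to [r / 2]. *)
Lemma shadows_improve (f : R -> R) (t : R) : shadows T a r f -> T + INR n * a <= t ->
  exists s, Rabs s <= eps /\ d (phi t x0) (phi (f t + s) x0) < r / 2.
Proof.
intros [Hf1 Hf2] Ht.
assert (Hk : forall k, (- Z.of_nat n <= k)%Z -> T <= t + IZR k * a).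
{ intros k Hk; apply IZR_le in Hk; rewrite opp_IZR, <- INR_IZR_INZ in Hk.
  assert (- INR n * a <= IZR k * a) by (apply Rmult_le_compat_r; lra); lra. }
destruct (Hunif (phi t x0) (phi (f t) x0) (fun k => f (t + IZR k * a) - f t)) as [s [Hs1 Hs2]].
- simpl; rewrite Rmult_0_l, Rplus_0_r; ring.
- intros k Hk'; specialize (Hf2 (t + IZR k * a) a (Hk k ltac:(lia)) ltac:(lra)).
  rewrite plus_IZR; replace (t + (IZR k + 1) * a) with (t + IZR k * a + a) by ring.
  unfold coarse_step; set (p := f (t + IZR k * a + a)) in *; set (q := f (t + IZR k * a)) in *.
  assert (- (a / 4) <= p - q - a <= a / 4) by (split; [|apply Rle_trans with (2 := Hf2), Rle_abs];
    pose proof (Rle_abs (- (p - q - a))); rewrite Rabs_Ropp in *; lra).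
  lra.
- intros k Hk'; rewrite !(flow_add X d phi Hphi).
  replace (f t + (f (t + IZR k * a) - f t)) with (f (t + IZR k * a)) by ring.
  specialize (Hf1 _ (Hk k ltac:(lia))); lra.
- exists s; rewrite (flow_add X d phi Hphi) in Hs2; auto.
Qed.

(* Going one turn further: follow [G] once and then [f], whose error at [G t] has been
   halved since [G t] is at least [n] steps away from the end point [T]. *)
Lemma shadows_next (f : R -> R) : shadows T a r f ->
  exists f', shadows T a r f' /\ forall t, T <= t -> Rabs (f' t - f (G t)) <= a / 8.
Proof.
intros Hf.
assert (HGT : forall t, T <= t -> T <= G t).
{ intros t Ht; destruct (HG t Ht) as [H _].
  assert (0 <= INR n * a) by (apply Rmult_le_pos; [apply pos_INR|lra]); lra. }
assert (Hs : forall t, exists s, T <= t ->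
  Rabs s <= eps /\ d (phi (G t) x0) (phi (f (G t) + s) x0) < r / 2).
{ intro t; destruct (Rle_or_lt T t) as [Ht|Ht].
  - destruct (shadows_improve f (G t) Hf) as [s Hs]; [destruct (HG t Ht); lra|].
    exists s; auto.
  - exists 0; intros; lra. }
apply choice in Hs; destruct Hs as [sigma Hs].
destruct Hf as [Hf1 Hf2].
assert (Hclose : forall t, T <= t -> d (phi t x0) (phi (f (G t) + sigma t) x0) <= r).
{ intros t Ht; destruct (HG t Ht) as (_ & H1 & _); destruct (Hs t Ht) as [_ H2].
  pose proof (d_tri d Hd (phi t x0) (phi (G t) x0) (phi (f (G t) + sigma t) x0)); lra. }
exists (fun t => f (G t) + sigma t); split; [split; [exact Hclose|]|].
- intros t s Ht Hs1; cbv beta.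
  set (v := f (G (t + s)) + sigma (t + s) - (f (G t) + sigma t)).
  (* A rough bound by [T0] suffices: closeness at both ends turns it into [a / 8], so time errors do
     not accumulate over the turns. *)
  assert (Hv : Rabs (v - s) < a / 8); [|lra].
  apply (Hlag (phi t x0) (phi (f (G t) + sigma t) x0)).
  + rewrite Rabs_pos_eq; lra.
  + destruct (Hs t Ht) as [H1 _]; destruct (Hs (t + s) ltac:(lra)) as [H2 _].
    destruct (HG t Ht) as (_ & _ & H3); specialize (H3 s ltac:(lra)).
    apply Rabs_le_inv in H1, H2; apply Rabs_def2 in H3.
    assert (Hf4 : - (a / 2) <= f (G (t + s)) - f (G t) - (G (t + s) - G t) <= a / 2).
    { destruct (Rle_or_lt (G t) (G (t + s))) as [Hle|Hlt].
      - assert (HGt := HGT t Ht).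
        (* [G (t + s) - G t] can slightly exceed [a], so it is covered by two half steps, each
           costing [a / 4]. *)
        set (h := (G (t + s) - G t) / 2).
        pose proof (Hf2 (G t) h HGt ltac:(unfold h; lra)) as H4.
        pose proof (Hf2 (G t + h) h ltac:(unfold h; lra) ltac:(unfold h; lra)) as H5.
        replace (G t + h + h) with (G (t + s)) in H5 by (unfold h; lra).
        apply Rabs_le_inv in H4, H5; unfold h in *; lra.
      (* [G] may decrease; a backward move is shorter than [a / 8], hence one step of [f] read in
         reverse. *)
      - assert (HGt := HGT (t + s) ltac:(lra)).
        pose proof (Hf2 (G (t + s)) (G t - G (t + s)) HGt ltac:(lra)) as H4.
        replace (G (t + s) + (G t - G (t + s))) with (G t) in H4 by ring.
        apply Rabs_le_inv in H4; lra. }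
    unfold v; apply Rabs_le; lra.
  + apply Hclose, Ht.
  + rewrite !(flow_add X d phi Hphi).
    replace (f (G t) + sigma t + v) with (f (G (t + s)) + sigma (t + s)) by (unfold v; ring).
    apply Hclose; lra.
- intros t Ht; cbv beta; replace (f (G t) + sigma t - f (G t)) with (sigma t - 0) by ring.
  apply Rlt_le, (Hlag (phi (G t) x0) (phi (f (G t)) x0) 0).
  + rewrite Rabs_R0; lra.
  + destruct (Hs t Ht) as [H _]; rewrite Rminus_0_r; lra.
  + apply Hf1, HGT, Ht.
  + rewrite !(flow_add X d phi Hphi), Rplus_0_r.
    destruct (Hs t Ht); lra.
Qed.

(** The choice is made on the subtype of shadowing maps, so that the recursion, started at the
    identity, carries its invariant. *)
Lemma shadows_seq : exists F : nat -> R -> R, (forall m, shadows T a r (F m)) /\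
  forall m t, T <= t -> Rabs (F (S m) t - F m (G t)) <= a / 8.
Proof.
assert (Hnext : forall f : {f | shadows T a r f}, exists f' : {f | shadows T a r f},
  forall t, T <= t -> Rabs (proj1_sig f' t - proj1_sig f (G t)) <= a / 8).
{ intros [f Hf]; destruct (shadows_next f Hf) as [f' [H1 H2]].
  exists (exist _ f' H1); exact H2. }
apply choice in Hnext; destruct Hnext as [nxt Hnxt].
set (F := fix F m := match m with O => exist _ _ shadows_id | S m => nxt (F m) end).
exists (fun m => proj1_sig (F m)); split.
- intro m; exact (proj2_sig (F m)).
- intros m; exact (Hnxt (F m)).
Qed.

(* The [q]-th term with [q = m N + i] is the trace at the [i]-th node of [T, G T] of
   the [m]-th turn; its distance to that node is bounded independently of [m]. *)
Lemma coarse_winding : exists (N : nat) (u : nat -> R) (b : nat -> X),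
  (0 < N)%nat /\ 1 <= INR N * a /\
  (forall q, coarse_step a (u (S q) - u q)) /\
  (forall q, d (b (q mod N)) (phi (u q) x0) <= r).
Proof.
destruct shadows_seq as (F & HF1 & HF2).
destruct (HG T (Rle_refl T)) as (HGT & _ & _).
assert (0 <= INR n * a) by (apply Rmult_le_pos; [apply pos_INR|lra]).
set (l := G T - T); assert (Hl : 1 <= l) by (unfold l; lra).
destruct (archimed (l / a)) as [HN1 HN2].
set (z := up (l / a)) in *.
assert (Hla : l / a * a = l) by (field; lra).
assert (Hz1 : l < IZR z * a) by (rewrite <- Hla; apply Rmult_lt_compat_r; lra).
assert (Hz2 : IZR z * a <= l + a).
{ assert ((IZR z - l / a) * a <= 1 * a) by (apply Rmult_le_compat_r; lra); lra. }
assert (Hz : (0 < z)%Z).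
{ apply lt_IZR, Rnot_le_lt; intro.
  assert (0 <= - IZR z * a) by (apply Rmult_le_pos; lra); lra. }
set (N := Z.to_nat z).
assert (HNz : INR N = IZR z) by (unfold N; rewrite INR_IZR_INZ, Z2Nat.id by lia; reflexivity).
rewrite <- HNz in Hz1, Hz2.
assert (HNpos : (0 < N)%nat) by (unfold N; lia).
assert (HNR : 0 < INR N) by (apply lt_0_INR; exact HNpos).
(* With [N] equal steps the last node is exactly [G T]. Since [8 a <= l], the step [a'] lies between
   [7 a / 8] and [a], which leaves room in a coarse step for errors [a / 4] and [a / 8]. *)
set (a' := l / INR N).
assert (Ha' : INR N * a' = l) by (unfold a'; field; lra).
assert (Ha'1 : 7 * a / 8 <= a' <= a).
{ split; apply Rmult_le_reg_l with (INR N); try exact HNR; rewrite Ha'.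
  - assert (8 * a <= l) by lra; lra.
  - lra. }
exists N, (fun q => F (q / N)%nat (T + INR (q mod N) * a')), (fun i => phi (T + INR i * a') x0).
assert (Hge : forall i, T <= T + INR i * a').
{ intro i; assert (0 <= INR i * a') by (apply Rmult_le_pos; [apply pos_INR|lra]); lra. }
split; [exact HNpos|split; [lra|split]].
- intro q; set (m := (q / N)%nat); set (i := (q mod N)%nat).
  assert (Hq : q = (N * m + i)%nat) by (apply Nat.div_mod; lia).
  assert (Hi : (i < N)%nat) by (apply Nat.mod_upper_bound; lia).
  pose proof (proj2 (HF1 m) (T + INR i * a') a' (Hge i) ltac:(lra)) as Hstep.
  apply Rabs_le_inv in Hstep.
  destruct (Nat.eq_dec (S i) N) as [He|Hne].
  (* The last step of a turn ends at [F (S m) T], within [a / 8] of [F m (G T)], the value at the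
     end of turn [m]. *)
  + replace (S q / N)%nat with (S m) by (apply Nat.div_unique with 0%nat; nia).
    replace (S q mod N)%nat with 0%nat by (apply Nat.mod_unique with (S m); nia).
    rewrite Rmult_0_l, Rplus_0_r.
    pose proof (HF2 m T (Rle_refl T)) as Hturn; apply Rabs_le_inv in Hturn.
    replace (T + INR i * a' + a') with (G T) in Hstep.
    2:{ rewrite <- He, S_INR in Ha'; unfold l in Ha'; lra. }
    unfold coarse_step; lra.
  + replace (S q / N)%nat with m by (apply Nat.div_unique with (S i); nia).
    replace (S q mod N)%nat with (S i) by (apply Nat.mod_unique with m; nia).
    rewrite S_INR; replace (T + (INR i + 1) * a') with (T + INR i * a' + a') by ring.
    unfold coarse_step; lra.
- intro q; apply HF1, Hge.
Qed.

End Shadowing.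

End Spiral.

(** * Limits of the turns and their periodicity *)

Section Winding.
Context (X : Type) (d : X -> X -> R) (phi : R -> X -> X).
Context (Hd : is_metric d) (Hc : d_compact d) (Hphi : is_flow d phi).
Context (eps del a r : R) (Ha : 0 < a).
Context (Hdel : forall x y h, Rep h ->
  (forall t, d (phi t x) (phi (h t) y) <= del) ->
  exists s, - eps <= s <= eps /\ y = phi s x).
Context (Hosc : forall x s, Rabs s <= 2 * a -> d x (phi s x) < del / 4).
Context (Hr : r <= del / 4).
Context (x0 : X) (N : nat) (u : nat -> R) (b : nat -> X).
Context (HN : (0 < N)%nat) (HNa : eps < INR N * a / 2).
Context (Hu : forall q, coarse_step a (u (S q) - u q)).
Context (Hb : forall q, d (b (q mod N)) (phi (u q) x0) <= r).

(** The full orbit follows the cycle of nodes [b 0, ..., b (N - 1)] in both time directions; the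
    remainder in [Z] is nonnegative also for negative [k]. *)
Definition anchored (x : X) : Prop :=
  exists w, coarse a w /\
    forall k, d (b (Z.to_nat (k mod Z.of_nat N))) (phi (w k) x) <= r.

(** At each index both orbits are near the same node, hence within [2 r <= del / 2] of each
    other. *)
Lemma anchored_same_orbit (x y : X) : anchored x -> anchored y ->
  exists s, - eps <= s <= eps /\ y = phi s x.
Proof.
intros [v [Hv1 Hv2]] [w [Hw1 Hw2]].
apply (expansive_coarse X d phi Hd Hphi eps del a Ha Hdel Hosc v w); auto.
intro k; specialize (Hv2 k); specialize (Hw2 k).
set (c := b _) in *.
pose proof (d_tri d Hd (phi (v k) x) c (phi (w k) y)).
rewrite (d_sym d Hd (phi (v k) x) c) in *; lra.
Qed.

(** Advancing by [N] indices keeps the residues, hence the nodes, and takes time at least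
    [N a / 2 > eps]. *)
Lemma anchored_shift (x : X) : anchored x ->
  exists p, eps < p /\ anchored (phi p x).
Proof.
intros [w [Hw1 Hw2]]; exists (w (Z.of_nat N)); split.
- pose proof (coarse_diff a w 0 (Z.of_nat N) ltac:(lia) (fun k _ => proj2 Hw1 k)) as H.
  rewrite (proj1 Hw1), <- INR_IZR_INZ in H; lra.
- exists (fun k => w (k + Z.of_nat N)%Z - w (Z.of_nat N)); split; [split|].
  + simpl; ring.
  + intro k; replace (k + 1 + Z.of_nat N)%Z with (k + Z.of_nat N + 1)%Z by ring.
    pose proof (proj2 Hw1 (k + Z.of_nat N)%Z); unfold coarse_step in *; lra.
  + intro k; rewrite (flow_add X d phi Hphi).
    replace (w (Z.of_nat N) + (w (k + Z.of_nat N)%Z - w (Z.of_nat N)))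
      with (w (k + Z.of_nat N)%Z) by ring.
    specialize (Hw2 (k + Z.of_nat N)%Z).
    replace ((k + Z.of_nat N) mod Z.of_nat N)%Z with (k mod Z.of_nat N)%Z in Hw2; [exact Hw2|].
    rewrite <- (Z_mod_plus_full k 1 (Z.of_nat N)); f_equal; ring.
Qed.

(** [phi p x] is also reached from [x] by a shift [s <= eps < p], so [p - s] is a period. *)
Lemma anchored_periodic (x : X) : anchored x -> exists T, 0 < T /\ phi T x = x.
Proof.
intro Hx; destruct (anchored_shift x Hx) as [p [Hp Hx']].
destruct (anchored_same_orbit _ _ Hx Hx') as [s [Hs Hps]].
exists (p - s); split; [lra|].
replace (p - s) with (p + - s) by ring; rewrite <- (flow_add X d phi Hphi), Hps.
rewrite (flow_add X d phi Hphi), Rplus_opp_r; apply Hphi.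
Qed.

Lemma winding_growth (q k : nat) :
  a / 2 * INR k <= u (q + k)%nat - u q <= 3 * a / 2 * INR k.
Proof.
induction k as [|k IH].
- rewrite Nat.add_0_r; simpl; lra.
- rewrite S_INR, Nat.add_succ_r; specialize (Hu (q + k)); unfold coarse_step in Hu; lra.
Qed.

Lemma winding_mono (p q : nat) : (p <= q)%nat -> u p <= u q.
Proof.
intro H; replace q with (p + (q - p))%nat by lia.
pose proof (winding_growth p (q - p)).
assert (0 <= a / 2 * INR (q - p)) by (apply Rmult_le_pos; [lra|apply pos_INR]); lra.
Qed.

Lemma winding_turn (t : R) : u 0%nat <= t ->
  exists m, u (N * m)%nat <= t < u (N * S m)%nat.
Proof.
intro Ht.
destruct (INR_unbounded ((t - u 0%nat) / (a / 2))) as [M HM].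
assert (HtM : t < u (N * M)%nat).
{ assert (HuM : t < u M).
  { pose proof (winding_growth 0 M) as H; simpl in H.
    assert (t - u 0%nat < a / 2 * INR M); [|lra].
    replace (t - u 0%nat) with (a / 2 * ((t - u 0%nat) / (a / 2))) by (field; lra).
    apply Rmult_lt_compat_l; lra. }
  pose proof (winding_mono M (N * M) ltac:(nia)); lra. }
clear HM; induction M as [|M IH].
- rewrite Nat.mul_0_r in HtM; lra.
- destruct (Rlt_or_le t (u (N * M)%nat)) as [Hlt|Hle]; [auto|exists M; auto].
Qed.

(** The times [tk j] fall into turns [m j] that tend to infinity. The initial points of these turns
    have an ultralimit [x], the times [u] recentred there have a coarse limit, and the bounded
    offsets inside the turns have a limit [theta]. *)
Lemma omega_anchored (z : X) : omega d phi x0 z ->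
  exists x theta, anchored x /\ z = phi theta x.
Proof.
intros [tk [Htk Hz]].
destruct free_ultrafilter_exists as [U HU].
assert (Hm : forall j, exists m, u 0%nat <= tk j -> u (N * m)%nat <= tk j < u (N * S m)%nat).
{ intro j; destruct (Rle_or_lt (u 0%nat) (tk j)) as [H|H].
  - destruct (winding_turn _ H) as [m Hm]; exists m; auto.
  - exists 0%nat; intros; lra. }
apply choice in Hm; destruct Hm as [m Hm].
assert (Htinf : forall B, U (fun j => B < tk j)).
{ intro B; destruct (Htk B) as [J HJ].
  apply (uf_mp U HU _ _ (uf_ge U HU J)); intros j Hj; apply HJ; exact Hj. }
assert (Hminf : forall K : nat, U (fun j => (K <= m j)%nat)).
{ intro K; apply (uf_mp2 U HU _ _ _ (Htinf (u 0%nat)) (Htinf (u (N * K)%nat))).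
  intros j H1 H2; destruct (Nat.le_gt_cases K (m j)) as [H|H]; [exact H|exfalso].
  pose proof (winding_mono (N * S (m j)) (N * K) ltac:(nia)).
  destruct (Hm j); lra. }
destruct (ulim_compact U HU X d Hd Hc (fun j => phi (u (N * m j)%nat) x0)) as [x Hx].
(* [Z.to_nat] truncates negative indices to 0; for fixed [k] this affects only those [j] with small
   [m j]. *)
set (v := fun j k => u (Z.to_nat (Z.of_nat (N * m j) + k)) - u (N * m j)%nat).
destruct (ulim_coarse a Ha U HU v) as [w [Hw1 Hw2]].
{ intro j; unfold v; rewrite Z.add_0_r, Nat2Z.id; ring. }
{ intro K; apply (uf_mp U HU _ _ (Hminf K)); intros j Hj k Hk; unfold v.
  replace (Z.to_nat (Z.of_nat (N * m j) + (k + 1)))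
    with (S (Z.to_nat (Z.of_nat (N * m j) + k))) by nia.
  specialize (Hu (Z.to_nat (Z.of_nat (N * m j) + k))); unfold coarse_step in *; lra. }
destruct (ulim_bounded U HU (3 * a / 2 * INR N) (fun j => tk j - u (N * m j)%nat))
  as [theta Htheta].
{ apply (uf_mp U HU _ _ (Htinf (u 0%nat))); intros j Hj.
  destruct (Hm j) as [H1 H2]; [lra|].
  replace (N * S (m j))%nat with (N * m j + N)%nat in H2 by ring.
  pose proof (winding_growth (N * m j) N); rewrite Rabs_pos_eq; lra. }
assert (Hflow : forall (t : nat -> R) l, ulim U Rdist t l ->
  ulim U d (fun j => phi (u (N * m j)%nat + t j) x0) (phi l x)).
{ intros t l Ht e He; pose proof (ulim_flow U HU X d Hd phi Hphi _ _ _ _ Ht Hx e He) as H.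
  apply (uf_mp U HU _ _ H); intros j Hj; rewrite (flow_add X d phi Hphi) in Hj; exact Hj. }
exists x, theta; split.
- exists w; split; [exact Hw1|]; intro k.
  apply (ulim_dist_le U HU X d Hd _ _ _ _ _ (ulim_const U HU X d Hd _) (Hflow _ _ (Hw2 k))).
  apply (uf_mp U HU _ _ (Hminf (Z.abs_nat k))); intros j Hj; unfold v.
  set (q := Z.to_nat (Z.of_nat (N * m j) + k)).
  replace (u (N * m j)%nat + (u q - u (N * m j)%nat)) with (u q) by ring.
  replace (Z.to_nat (k mod Z.of_nat N)) with (q mod N)%nat; [apply Hb|].
  assert (0 <= Z.of_nat (N * m j) + k)%Z by nia.
  unfold q; rewrite <- (Nat2Z.id N) at 2.
  rewrite <- Z2Nat.inj_mod by lia; f_equal.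
  rewrite <- (Z_mod_plus_full k (Z.of_nat (m j)) (Z.of_nat N)); f_equal; lia.
- apply (ulim_unique U HU X d Hd (fun j => phi (tk j) x0)).
  + intros e He; destruct (Hz e He) as [J HJ].
    apply (uf_mp U HU _ _ (uf_ge U HU J)); intros j Hj; apply HJ, Hj.
  + intros e He; apply (uf_mp U HU _ _ (Hflow _ _ Htheta e He)); intros j Hj.
    replace (u (N * m j)%nat + (tk j - u (N * m j)%nat)) with (tk j) in Hj by ring; exact Hj.
Qed.

End Winding.

(** * The omega-limit set and the conclusion *)

Lemma omega_nonempty (X : Type) (d : X -> X -> R) (phi : R -> X -> X) (x0 : X) :
  is_metric d -> d_compact d -> exists z, omega d phi x0 z.
Proof.
intros Hd Hc; destruct free_ultrafilter_exists as [U HU].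
destruct (ulim_compact U HU X d Hd Hc (fun n => phi (INR n) x0)) as [z Hz].
assert (Hk : forall k : nat, exists n : nat, (k <= n)%nat /\ d (phi (INR n) x0) z < / INR (k + 1)).
{ intro k; apply (uf_ex U HU), (uf_and U HU); [apply (uf_ge U HU)|].
  apply Hz, Rinv_0_lt_compat, lt_0_INR; lia. }
apply choice in Hk; destruct Hk as [n Hn].
exists z, (fun k => INR (n k)); split.
- intro M; destruct (INR_unbounded M) as [K HK]; exists K; intros k Hk.
  destruct (Hn k) as [H _]; pose proof (le_INR K (n k) ltac:(lia)); lra.
- intros e He; destruct (archimed_cor1 e He) as [K [HK1 HK2]].
  exists K; intros k Hk; destruct (Hn k) as [_ H].
  pose proof (Rinv_le_contravar (INR K) (INR (k + 1)) ltac:(apply lt_0_INR; lia)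
    ltac:(apply le_INR; lia)); lra.
Qed.

Lemma omega_invariant (X : Type) (d : X -> X -> R) (phi : R -> X -> X) (x0 : X) :
  is_flow d phi -> is_metric d ->
  forall z t, omega d phi x0 z -> omega d phi x0 (phi t z).
Proof.
intros Hphi Hd z t [tk [Htk Hz]]; exists (fun k => tk k + t); split.
- intro M; destruct (Htk (M - t)) as [K HK]; exists K; intros k Hk.
  specialize (HK k Hk); lra.
- intros e He; destruct (proj1 Hphi t z e He) as [del [Hdel H]].
  destruct (Hz del Hdel) as [K HK]; exists K; intros k Hk.
  rewrite <- (flow_add X d phi Hphi), (d_sym d Hd); apply H.
  + rewrite Rminus_diag, Rabs_R0; exact Hdel.
  + rewrite (d_sym d Hd); auto.
Qed.

Theorem theorem3p1 (X : Type) (d : X -> X -> R) (phi : R -> X -> X) (x0 : X) :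
  is_metric d -> d_compact d ->
  is_flow d phi -> regular_flow phi -> expansive d phi ->
  spiral_point d phi x0 ->
  periodic_orbit phi (omega d phi x0).
Proof.
intros Hd Hc Hphi Hreg Hexp Hsp.
destruct (injectivity_time_exists X d phi Hd Hc Hphi Hreg) as (T0 & HT0 & Hinj).
(* Two shifts of size [T0 / 8] and the drift of one step stay below [T0], as the time lag estimate
   requires. *)
destruct (Hexp (T0 / 8) ltac:(lra)) as (del & Hdelpos & Hdel).
destruct (flow_small_time X d phi Hd Hc Hphi (del / 4) ltac:(lra)) as (a0 & Ha0 & Hosc0).
assert (Ha : exists a, 0 < a <= T0 / 8 /\ 2 * a <= a0).
{ exists (Rmin (T0 / 8) (a0 / 2)).
  pose proof (Rmin_l (T0 / 8) (a0 / 2)); pose proof (Rmin_r (T0 / 8) (a0 / 2)).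
  repeat split; try lra; apply Rmin_glb_lt; lra. }
destruct Ha as (a & Ha & Haa0).
assert (Hosc : forall x s, Rabs s <= 2 * a -> d x (phi s x) < del / 4)
  by (intros x s Hs; apply Hosc0; lra).
destruct (time_lag_small X d phi Hd Hc Hphi T0 (a / 8) Hinj ltac:(lra)) as (eta & Heta & Hlag0).
assert (Hr : exists r, 0 < r <= del / 4 /\ r <= eta).
{ exists (Rmin (del / 4) eta).
  pose proof (Rmin_l (del / 4) eta); pose proof (Rmin_r (del / 4) eta).
  repeat split; try lra; apply Rmin_glb_lt; lra. }
destruct Hr as (r & Hr & Hreta).
destruct (expansive_uniform X d phi Hd Hc Hphi (T0 / 8) del a ltac:(lra) Hdel Hosc (r / 2)
  ltac:(lra)) as [n Hunif].
(* In [1 + n a], the 1 makes a turn at least [8 a] long, and [n a] puts [G t] far enough after [T]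
   for a window of [n] steps. *)
destruct (spiral_return X d phi Hd Hc Hphi x0 T0 (a / 8) (r / 2) (1 + INR n * a) Hinj
  ltac:(lra) ltac:(lra) Hsp) as (T & G & HG).
destruct (coarse_winding X d phi Hd Hphi x0 T0 (T0 / 8) del a r T n G) as
  (N & u & b & HN & HNa & Hu & Hb); auto; try lra.
{ intros x y s v Hs Hv Hxy Hsv; apply (Hlag0 x y); lra. }
assert (HNeps : T0 / 8 < INR N * a / 2) by lra.
assert (Hom := omega_anchored X d phi Hd Hc Hphi a r ltac:(lra) x0 N u b HN Hu Hb).
assert (Horb := anchored_same_orbit X d phi Hd Hphi (T0 / 8) del a r ltac:(lra) Hdel Hosc
  ltac:(lra) N b).
destruct (omega_nonempty X d phi x0 Hd Hc) as [z0 Hz0].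
destruct (Hom z0 Hz0) as (p & theta & Hp & Hz0p).
destruct (anchored_periodic X d phi Hd Hphi (T0 / 8) del a r ltac:(lra) Hdel Hosc
  ltac:(lra) N b HN HNeps p Hp) as (P & HP & HPp).
exists p, P; split; [exact HP|split; [exact HPp|]]; intro z; split.
- intro Hz; destruct (Hom z Hz) as (q & th & Hq & ->).
  destruct (Horb p q Hp Hq) as (s & _ & ->).
  exists (s + th); apply (flow_add X d phi Hphi).
- intros [t ->].
  (* The orbit of [p] passes through [z0], a point of the limit set, so invariance yields the whole
     orbit. *)
  replace (phi t p) with (phi (t - theta) z0).
  + apply omega_invariant; assumption.
  + rewrite Hz0p, (flow_add X d phi Hphi); f_equal; ring.
Qed.
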